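(* Let $S\subset\mathbb{R}^2$ be a finite set of distinct points with $|S|$ odd. For a point $x\in S$, the following three conditions are equivalent: (i) every line through $x$ is good; (ii) every perfect line contains $x$; (iii) every line through $x$ is even-balanced about $x$. Alice wins if and only if there exists a point $x\in S$ satisfying these conditions, and in that case $a=x$ is a winning point for Alice.
   Context: The game: Alice chooses $a\in\mathbb{R}^2$; then Bob, knowing $a$, chooses $b\in\mathbb{R}^2$. With $\rho$ the Euclidean distance, $V_A=|\{y\in S:\rho(a,y)<\rho(b,y)\}|$ and $V_B=|\{y\in S:\rho(b,y)<\rho(a,y)\}|$. A point $a$ is a winning point for Alice if $V_A\ge V_B$ for every $b$; Alice wins if a winning point exists. A line $l$ in the plane is good if the two open half-planes bounded by $l$ contain the same number of points of $S$, and perfect if it is good and contains exactly one point of $S$. For a line $l$ through $x$, $l^+,l^-$ denote the two open half-lines into which $x$ divides $l$; $l$ is even-balanced about $x$ if $|l^+\cap S|=|l^-\cap S|$. *)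

(* Defs.v *)
(* MathComp world: the real numbers are an arbitrary [R : realType] and a finite
   set of points of the plane is an [{fset R * R}]. *)
From mathcomp Require Export all_boot all_order all_algebra.
From mathcomp Require Export finmap.
From mathcomp Require Export reals.

Set Implicit Arguments.
Unset Strict Implicit.
Unset Printing Implicit Defensive.

Import Order.TTheory GRing.Theory Num.Theory.
Local Open Scope fset_scope.
Local Open Scope ring_scope.

Definition dotp (R : realType) (u v : R * R) : R := u.1 * v.1 + u.2 * v.2.

(* Written out because the library norm on [R * R] is the max norm. *)
Definition dist (R : realType) (p q : R * R) : R :=
  Num.sqrt ((p.1 - q.1) ^+ 2 + (p.2 - q.2) ^+ 2).

Definition votes_A (R : realType) (S : {fset R * R}) (a b : R * R) : nat :=
  #|` [fset y in S | dist a y < dist b y]|.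

Definition votes_B (R : realType) (S : {fset R * R}) (a b : R * R) : nat :=
  #|` [fset y in S | dist b y < dist a y]|.

Definition winning_point (R : realType) (S : {fset R * R}) (a : R * R) : Prop :=
  forall b : R * R, (votes_B S a b <= votes_A S a b)%N.

Definition alice_wins (R : realType) (S : {fset R * R}) : Prop :=
  exists a : R * R, winning_point S a.

(* The line { p | normal . p = offset }.  Proportional equations give the same
   line; rescaling can only exchange the two half-planes, or the two half-lines,
   defined below, so the notions built on them depend only on the line itself. *)
Record line (R : realType) := Line {
  normal : R * R;
  offset : R;
  normal_neq0 : normal != 0
}.

Definition on_line (R : realType) (l : line R) (p : R * R) : bool :=
  dotp (normal l) p == offset l.

Definition pos_half_plane (R : realType) (l : line R) (p : R * R) : bool :=
  offset l < dotp (normal l) p.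

Definition neg_half_plane (R : realType) (l : line R) (p : R * R) : bool :=
  dotp (normal l) p < offset l.

Definition good (R : realType) (S : {fset R * R}) (l : line R) : Prop :=
  #|` [fset y in S | pos_half_plane l y]| =
  #|` [fset y in S | neg_half_plane l y]|.

Definition perfect (R : realType) (S : {fset R * R}) (l : line R) : Prop :=
  good S l /\ #|` [fset y in S | on_line l y]| = 1%N.

Definition direction (R : realType) (l : line R) : R * R :=
  (- (normal l).2, (normal l).1).

(* The open half-lines into which a point [x] of [l] divides [l]. *)
Definition pos_half_line (R : realType) (l : line R) (x p : R * R) : bool :=
  on_line l p && (0 < dotp (direction l) (p - x)).

Definition neg_half_line (R : realType) (l : line R) (x p : R * R) : bool :=
  on_line l p && (dotp (direction l) (p - x) < 0).

Definition even_balanced (R : realType) (S : {fset R * R}) (l : line R)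
    (x : R * R) : Prop :=
  #|` [fset y in S | pos_half_line l x y]| =
  #|` [fset y in S | neg_half_line l x y]|.

Definition all_lines_good (R : realType) (S : {fset R * R}) (x : R * R) : Prop :=
  forall l : line R, on_line l x -> good S l.

Definition all_perfect_lines_through (R : realType) (S : {fset R * R})
    (x : R * R) : Prop :=
  forall l : line R, perfect S l -> on_line l x.

Definition all_lines_even_balanced (R : realType) (S : {fset R * R})
    (x : R * R) : Prop :=
  forall l : line R, on_line l x -> even_balanced S l x.

(* Main.v *)
(* Call [x] central if no open half-plane whose boundary passes through [x]
   contains more than half of [S].  Answering [a] by a point very close to it
   shows that a winning point is central.  If [x] is central, tilting a line
   through [x] slightly in both directions moves its two open half-lines into
   opposite half-planes, and since [#|S|] is odd this forces [x] into [S] and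
   makes the line both good and even-balanced.  If every perfect line contains
   [x], then [x] is the median of [S] in every generic direction, hence central.
   If every line through [x] is even-balanced, opposite half-planes match ray by
   ray, so every line through [x] is good; and then [x] is winning because [b]
   only gets votes from an open half-plane bounded by a line through [x]. *)
Require Import Defs.
From mathcomp Require Import all_boot all_order all_algebra.
From mathcomp Require Import finmap reals.
From mathcomp Require Import zify ring lra.

Set Implicit Arguments.
Unset Strict Implicit.
Unset Printing Implicit Defensive.

Import Order.TTheory GRing.Theory Num.Theory.
Local Open Scope fset_scope.
Local Open Scope ring_scope.

(** * Counting in finite sets, and medians *)

Lemma card_fset_sep (K : choiceType) (S : {fset K}) (P : pred K) :
  #|` [fset y in S | P y]| = count P S.
Proof.
rewrite -size_filter; apply/perm_size/uniq_perm; rewrite ?fset_uniq //.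
  by rewrite filter_uniq ?fset_uniq.
by move=> y; rewrite mem_filter !inE /= andbC.
Qed.

Lemma sub_in_count (T : eqType) (s : seq T) (P Q : pred T) :
  {in s, forall y, P y -> Q y} -> (count P s <= count Q s)%N.
Proof.
move=> PQ; rewrite -(@eq_in_count _ (predI P Q)) ?count_predI; last first.
  by move=> y ys /=; case Py: (P y) => //=; rewrite PQ.
by apply: sub_count => y /= /andP[].
Qed.

Lemma sub_count_disjoint2 (T : eqType) (s : seq T) (P Q U : pred T) :
  {in s, forall y, P y || Q y -> U y} -> (forall y, P y -> ~~ Q y) ->
  (count P s + count Q s <= count U s)%N.
Proof.
move=> PQU PQ; rewrite -count_predUI [X in (_ + X)%N](@eq_count _ _ pred0).
  by rewrite count_pred0 addn0; apply: sub_in_count.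
by move=> y /=; apply/negbTE; rewrite negb_and -implybE; apply/implyP/PQ.
Qed.

Lemma exists_median (R : realType) (T : choiceType) (S : {fset T}) (g : T -> R) :
  odd #|` S| -> {in S &, injective g} ->
  exists2 m, m \in S & count (fun y => g y < g m) S = count (fun y => g m < g y) S.
Proof.
move=> hS ginj; pose rank m := count (fun y => g y < g m) S.
have rank_ltn m : m \in S -> (rank m < #|` S|)%N.
  move=> mS; rewrite -[ltnRHS](count_predT S).
  have -> : (rank m).+1 = (rank m + count_mem m S)%N.
    by rewrite count_uniq_mem ?fset_uniq // mS addn1.
  apply: sub_count_disjoint2 => // y.
  by apply: contraTN => /eqP->; rewrite ltxx.
have rank_mono m m' : m \in S -> g m < g m' -> (rank m < rank m')%N.
  move=> mS mm'; have -> : (rank m).+1 = (rank m + count_mem m S)%N.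
    by rewrite count_uniq_mem ?fset_uniq // mS addn1.
  apply: sub_count_disjoint2 => y.
    by move=> _ /orP[/lt_trans->|/eqP->].
  by apply: contraTN => /eqP->; rewrite ltxx.
have rank_inj : {in S &, injective rank}.
  move=> m m' mS m'S E; apply: ginj => //.
  by case: (ltgtP (g m) (g m')) =>
    // [/(rank_mono _ _ mS)|/(rank_mono _ _ m'S)]; rewrite E ltnn.
have rank_uniq : uniq (map rank S) by rewrite map_inj_in_uniq ?fset_uniq.
have rank_sub : {subset map rank S <= iota 0 #|` S|}.
  by move=> k /mapP[m mS ->]; rewrite mem_iota rank_ltn.
have [|_ onto] := uniq_min_size rank_uniq rank_sub.
  by rewrite size_iota size_map.
have : (#|` S|./2 \in iota 0 #|` S|)%N by rewrite mem_iota; lia.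
rewrite -onto => /mapP[m mS rm]; exists m => //.
have total : (rank m + count (fun y => g m < g y)%R S + 1 = #|` S|)%N.
  have <- : (m \in S : nat) = 1%N by rewrite mS.
  rewrite -(count_uniq_mem m (fset_uniq S)) /rank.
  have: {subset (enum_fset S) <= S} by [].
  elim: (enum_fset S) => //= y t IH yt.
  rewrite -IH; last by move=> z zt; apply: yt; rewrite inE zt orbT.
  have yS : y \in S by apply: yt; rewrite mem_head.
  have [->|ym] := eqVneq y m; first by rewrite ltxx; lia.
  by case: ltgtP => [_|_|/(ginj _ _ yS mS)/eqP]; rewrite ?(negbTE ym) //; lia.
by move: total hS; rewrite -/(rank m); lia.
Qed.

(** * Scalar products, distances and small perturbations *)

Section Plane.
Variable R : realType.
Implicit Types (S : {fset R * R}) (a b d p u v w x y z : R * R).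

Lemma dotpBr v y x : dotp v (y - x) = dotp v y - dotp v x.
Proof. by rewrite /dotp /=; ring. Qed.

Lemma dotpDl v w y : dotp (v + w) y = dotp v y + dotp w y.
Proof. by rewrite /dotp /=; ring. Qed.

Lemma dotpNl v y : dotp (- v) y = - dotp v y.
Proof. by rewrite /dotp /=; ring. Qed.

(* The regular scaling would need the carrier [R^o * R^o]. *)
Definition scale2 (t : R) v : R * R := (t * v.1, t * v.2).

Lemma dotpZl (t : R) v y : dotp (scale2 t v) y = t * dotp v y.
Proof. by rewrite /dotp /=; ring. Qed.

Definition rot v : R * R := (- v.2, v.1).

Lemma dotp_gt0 v : v != 0 -> 0 < dotp v v.
Proof.
move=> v0; rewrite lt_neqAle /dotp addr_ge0 -?expr2 ?sqr_ge0 // andbT eq_sym.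
rewrite paddr_eq0 ?sqr_ge0 // !sqrf_eq0; apply: contra v0.
by case: v => v1 v2 /= /andP[/eqP-> /eqP->].
Qed.

Lemma rot_neq0 v : v != 0 -> rot v != 0.
Proof.
case: v => v1 v2; apply: contra => /eqP[/eqP]; rewrite oppr_eq0 => /eqP-> ->.
by [].
Qed.

Lemma dotp_rot_eq0 v d : v != 0 -> dotp v d = 0 -> dotp (rot v) d = 0 -> d = 0.
Proof.
move=> /dotp_gt0/lt0r_neq0 v0; rewrite /dotp /rot /= => vd wd.
have d1 : dotp v v * d.1 = 0.
  rewrite /dotp (_ : _ * _ = v.1 * (v.1 * d.1 + v.2 * d.2)
    - v.2 * (- v.2 * d.1 + v.1 * d.2)); last by ring.
  by rewrite vd wd !mulr0 subr0.
have d2 : dotp v v * d.2 = 0.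
  rewrite /dotp (_ : _ * _ = v.2 * (v.1 * d.1 + v.2 * d.2)
    + v.1 * (- v.2 * d.1 + v.1 * d.2)); last by ring.
  by rewrite vd wd !mulr0 addr0.
move: d1 d2 => /eqP; rewrite mulf_eq0 (negbTE v0) => /eqP d1.
move=> /eqP; rewrite mulf_eq0 (negbTE v0) => /eqP d2.
by case: d d1 d2 {vd wd} => ? ? /= -> ->.
Qed.

(** After squaring, the terms quadratic in [y] cancel: for distinct [a] and [b] the votes for [a]
    come from one open side of the perpendicular bisector. *)
Lemma dist_lt a b y :
  (dist a y < dist b y) =
  (dotp (b - a) (y - a) *+ 2 < dotp (b - a) (b - a)).
Proof.
rewrite /dist ltNge ler_sqrt ?addr_ge0 ?sqr_ge0 // -ltNge.
rewrite -[LHS]subr_gt0 -[RHS]subr_gt0; congr (_ < _).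
by rewrite /dotp /=; ring.
Qed.

Lemma dist_gt a b y :
  (dist b y < dist a y) =
  (dotp (b - a) (b - a) < dotp (b - a) (y - a) *+ 2).
Proof.
rewrite /dist ltNge ler_sqrt ?addr_ge0 ?sqr_ge0 // -ltNge.
rewrite -[LHS]subr_gt0 -[RHS]subr_gt0; congr (_ < _).
by rewrite /dotp /=; ring.
Qed.

(** Each pair holds a quantity and its rate of change; one step size [e] preserves the sign of all
    the nonzero quantities at once. *)
Lemma small_perturbation (s : seq (R * R)) :
  exists2 e : R, 0 < e & forall c, c \in s -> c.1 != 0 -> `|e * c.2| < `|c.1|.
Proof.
(* Asking for every smaller positive [e'] as well lets the induction pass to a minimum. *)
suff [e e0 He] : exists2 e : R, 0 < e & forall e', 0 < e' <= e ->
    forall c, c \in s -> c.1 != 0 -> `|e' * c.2| < `|c.1|.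
  by exists e => //; apply: He; rewrite e0 lexx.
elim: s => [|[a b] s [e e0 IH]]; first by exists 1.
have [->|a0] := eqVneq a 0.
  exists e => // e' He c; rewrite inE => /orP[/eqP->|cs]; first by rewrite eqxx.
  exact: IH.
have b1 : 0 < `|b| + 1 by rewrite ltr_wpDl.
exists (Num.min e (`|a| / (`|b| + 1))).
  by rewrite lt_min e0 divr_gt0 ?normr_gt0.
move=> e' /andP[e'0]; rewrite le_min => /andP[e'e e'a] c.
rewrite inE => /orP[/eqP-> /= _|cs]; last by apply: IH; rewrite ?e'0.
rewrite normrM (gtr0_norm e'0); move: e'a; rewrite ler_pdivlMr // => e'a.
by apply: lt_le_trans e'a; rewrite ltr_pM2l // ltrDl.
Qed.

Lemma small_perturbation_sg (r t : R) :
  `|t| < `|r| -> (0 < r -> 0 < r + t) /\ (r < 0 -> r + t < 0).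
Proof.
move=> tr; split=> r0; move: tr.
  by rewrite (gtr0_norm r0) ltr_norml => /andP[]; lra.
by rewrite (ltr0_norm r0) ltr_norml => /andP[]; lra.
Qed.

(** * Open half-planes bounded by a line through a point, and central points *)

Definition half_count S x v : nat := count (fun y => 0 < dotp v (y - x)) S.

Definition central S x : Prop :=
  forall v, ((half_count S x v).*2 <= #|` S|)%N.

Lemma winning_point_central S a : winning_point S a -> central S a.
Proof.
move=> win v.
(* The point [y] prefers [a + scale2 e v] iff [dotp v (y - a) - e * (dotp v v / 2)] is positive. *)
have [e e0 He] := small_perturbation
  [seq (dotp v (y - a), - (dotp v v / 2)) | y <- S].
have := win (a + scale2 e v); rewrite /votes_A /votes_B !card_fset_sep => BA.
have ba : a + scale2 e v - a = scale2 e v by rewrite addrC addKr.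
have vvE : dotp (scale2 e v) (scale2 e v) = e ^+ 2 * dotp v v.
  by rewrite /dotp /=; ring.
have near y : y \in (S : {fset _}) -> 0 < dotp v (y - a) ->
    dist (a + scale2 e v) y < dist a y.
  move=> yS vy.
  rewrite dist_gt ba vvE dotpZl.
  have /small_perturbation_sg[/(_ vy) /= H _] :=
    He _ (map_f _ yS) (lt0r_neq0 vy).
  rewrite expr2 -mulrA -mulrnAr ltr_pM2l //; move: H; lra.
have fB : (half_count S a v <=
    count (fun y => dist (a + scale2 e v) y < dist a y)%R S)%N.
  exact: sub_in_count.
have AB : (count (fun y => dist (a + scale2 e v) y < dist a y)%R S +
    count (fun y => dist a y < dist (a + scale2 e v) y)%R S <= count predT S)%N.
  by apply: sub_count_disjoint2 => // y /ltW; rewrite -leNgt.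
rewrite count_predT in AB; apply: leq_trans AB.
by rewrite -addnn leq_add // (leq_trans fB BA).
Qed.

Lemma central_balanced S x v : odd #|` S| -> central S x -> v != 0 ->
  [/\ x \in S,
      half_count S x v = half_count S x (- v) &
      count (fun y => (dotp v (y - x) == 0) && (0 < dotp (rot v) (y - x))) S =
      count (fun y => (dotp v (y - x) == 0) && (dotp (rot v) (y - x) < 0)) S].
Proof.
move=> hS cS v0.
set r := count _ S; set s := count _ S.
(* The plane splits into two open half-planes, two open half-lines and [x] itself. *)
have total : (half_count S x v + half_count S x (- v) + r + s + (x \in S) =
    #|` S|)%N.
  have one y : (1 = (0 < dotp v (y - x))%R + (0 < dotp (- v) (y - x))%R +
      ((dotp v (y - x) == 0) && (0 < dotp (rot v) (y - x)))%R +
      ((dotp v (y - x) == 0) && (dotp (rot v) (y - x) < 0))%R + (y == x))%N.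
    rewrite dotpNl oppr_gt0; have [->|yx] := eqVneq y x.
      by rewrite subrr /dotp /= !mulr0 addr0 !ltxx andbF.
    have := @dotp_rot_eq0 v (y - x) v0.
    case: ltgtP => //= vyx /(_ (esym vyx)) H.
    case: ltgtP H => //= wyx /(_ (esym wyx)) /eqP.
    by rewrite subr_eq0 (negbTE yx).
  rewrite -(count_uniq_mem x (fset_uniq S)) /half_count /r /s.
  elim: (enum_fset S) => //= y t <-; have := one y.
  move: (nat_of_bool _) (nat_of_bool _) (nat_of_bool _) (nat_of_bool _) => *.
  by lia.
(* For small [e], the normal [u + scale2 e w] keeps the points of [S] in the open half-plane of [u]
   and gains those of the boundary line on the side of [w]. *)
have tilt u : u != 0 -> forall w,
    ((half_count S x u + count (fun y =>
       (dotp u (y - x) == 0) && (0 < dotp w (y - x)))%R S).*2 <= #|` S|)%N.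
  move=> u0 w.
  have [e e0 He] := small_perturbation
    [seq (dotp u (y - x), dotp w (y - x)) | y <- S].
  apply: leq_trans (cS (u + scale2 e w)); rewrite leq_double.
  apply: sub_count_disjoint2 => [y yS|y /lt0r_neq0/negbTE uy]; last first.
    by rewrite uy.
  rewrite dotpDl dotpZl => /orP[uy|/andP[/eqP-> wy]].
    by have /small_perturbation_sg[/(_ uy)] := He _ (map_f _ yS) (lt0r_neq0 uy).
  by rewrite add0r mulr_gt0.
have Nv0 : - v != 0 by rewrite oppr_eq0.
have E1 u : count (fun y =>
    (dotp u (y - x) == 0) && (0 < dotp (- rot v) (y - x))) S =
    count (fun y => (dotp u (y - x) == 0) && (dotp (rot v) (y - x) < 0)) S.
  by apply: eq_count => y; rewrite /= dotpNl oppr_gt0.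
have E2 (P : pred (R * R)) : count (fun y => (dotp (- v) (y - x) == 0) && P y) S =
    count (fun y => (dotp v (y - x) == 0) && P y) S.
  by apply: eq_count => y; rewrite /= dotpNl oppr_eq0.
(* Each open half-plane together with each half-line has at most [(#|] S| - 1) /
   2[points. Two complementary sums add up to]#|[S| - (x \in S)], so [x] is in [S] and all four
   bounds are equalities. *)
have := tilt v v0 (rot v); have := tilt v v0 (- rot v).
have := tilt (- v) Nv0 (rot v); have := tilt (- v) Nv0 (- rot v).
rewrite !E1 !E2 -/r -/s; move: total hS.
case: (x \in S) => /=; move: (half_count _ _ _) (half_count _ _ _) => p q.
  by move=> *; split=> //; lia.
by move=> *; exfalso; lia.
Qed.

(** * Good, perfect and even-balanced lines *)

Lemma on_lineP (l : line R) x : on_line l x -> offset l = dotp (normal l) x.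
Proof. by move/eqP. Qed.

Lemma good_half_count S x (l : line R) : on_line l x ->
  good S l <-> half_count S x (normal l) = half_count S x (- normal l).
Proof.
move=> /on_lineP lx; rewrite /good !card_fset_sep /half_count.
rewrite (@eq_count _ (pos_half_plane l) (fun y => 0 < dotp (normal l) (y - x))).
  rewrite (@eq_count _ (neg_half_plane l)
    (fun y => 0 < dotp (- normal l) (y - x))) //.
  by move=> y; rewrite /neg_half_plane lx dotpNl dotpBr oppr_gt0 subr_lt0.
by move=> y; rewrite /pos_half_plane lx dotpBr subr_gt0.
Qed.

Lemma even_balanced_count S x (l : line R) : on_line l x ->
  even_balanced S l x <->
  count (fun y => (dotp (normal l) (y - x) == 0) &&
                  (0 < dotp (rot (normal l)) (y - x))) S =
  count (fun y => (dotp (normal l) (y - x) == 0) &&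
                  (dotp (rot (normal l)) (y - x) < 0)) S.
Proof.
move=> /on_lineP lx; rewrite /even_balanced !card_fset_sep.
by under eq_count do rewrite /pos_half_line /on_line lx -subr_eq0 -dotpBr;
   under [in X in _ = X <-> _]eq_count do
     rewrite /neg_half_line /on_line lx -subr_eq0 -dotpBr.
Qed.

Lemma central_mem S x : odd #|` S| -> central S x -> x \in S.
Proof.
move=> hS cS; have v0 : (1, 0) != 0 :> R * R.
  by apply/eqP => -[/eqP]; rewrite oner_eq0.
by case: (central_balanced hS cS v0).
Qed.

Lemma central_good S x : odd #|` S| -> central S x -> all_lines_good S x.
Proof.
move=> hS cS l lx; apply/(good_half_count _ lx).
by case: (central_balanced hS cS (normal_neq0 l)).
Qed.

Lemma central_even_balanced S x :
  odd #|` S| -> central S x -> all_lines_even_balanced S x.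
Proof.
move=> hS cS l lx; apply/(even_balanced_count _ lx).
by case: (central_balanced hS cS (normal_neq0 l)).
Qed.

Lemma all_lines_good_winning S x : all_lines_good S x -> winning_point S x.
Proof.
move=> gS b; rewrite /votes_A /votes_B !card_fset_sep.
have [->|bx] := eqVneq b x; first by [].
have v0 : b - x != 0 by rewrite subr_eq0.
pose l := Line (dotp (b - x) x) v0.
have lx : on_line l x by rewrite /on_line eqxx.
have /(good_half_count _ lx) /= E := gS l lx.
have vv := dotp_gt0 v0.
(* Every vote for [b] comes from the side of [l] containing [b], and every point strictly on the
   other side votes for [x]. *)
apply: (@leq_trans (half_count S x (b - x))).
  by apply: sub_count => y /=; rewrite dist_gt mulr2n; lra.
by rewrite E; apply: sub_count => y /=; rewrite dist_lt dotpNl mulr2n; lra.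
Qed.

(** If a perfect line missed [x], translating it onto [x] would add its point to one side and remove
    [x] from the other, so the two parallel lines could not both be good. *)
Lemma all_lines_good_perfect S x : x \in S ->
  all_lines_good S x -> all_perfect_lines_through S x.
Proof.
move=> xS gS l [gl l1]; apply: contraT => nlx.
pose l' := Line (dotp (normal l) x) (normal_neq0 l).
have lx : on_line l' x by rewrite /on_line eqxx.
have := gS l' lx; move: gl l1; rewrite /good !card_fset_sep.
move: nlx; rewrite /on_line /pos_half_plane /neg_half_plane /=.
move: (normal l) (offset l) => v c vx gl l1 gx.
have x1 : (0 < count_mem x S)%N by rewrite -has_count has_pred1.
case: (ltgtP (dotp v x) c) vx => // vxc _.
- have A : (count (fun y => c < dotp v y)%R S + count (fun y => dotp v y == c)%R S
      <= count (fun y => dotp v x < dotp v y)%R S)%N.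
    apply: sub_count_disjoint2 => y; last first.
      by apply: contraTN => /eqP->; rewrite ltxx.
    by move=> _ /orP[|/eqP->//]; apply: lt_trans.
  have B : (count (fun y => dotp v y < dotp v x)%R S + count_mem x S
      <= count (fun y => dotp v y < c)%R S)%N.
    apply: sub_count_disjoint2 => y; last first.
      by apply: contraTN => /eqP->; rewrite ltxx.
    by move=> _ /orP[|/eqP->//] /lt_trans; apply.
  by move: A B x1 gl l1 gx; lia.
- have A : (count (fun y => dotp v y < c)%R S + count (fun y => dotp v y == c)%R S
      <= count (fun y => dotp v y < dotp v x)%R S)%N.
    apply: sub_count_disjoint2 => y; last first.
      by apply: contraTN => /eqP->; rewrite ltxx.
    by move=> _ /orP[|/eqP->//] /lt_trans; apply.
  have B : (count (fun y => dotp v x < dotp v y)%R S + count_mem x S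
      <= count (fun y => c < dotp v y)%R S)%N.
    apply: sub_count_disjoint2 => y; last first.
      by apply: contraTN => /eqP->; rewrite ltxx.
    by move=> _ /orP[|/eqP->//]; apply: lt_trans.
  by move: A B x1 gl l1 gx; lia.
Qed.

Lemma all_perfect_central S x : odd #|` S| -> x \in S ->
  all_perfect_lines_through S x -> central S x.
Proof.
move=> hS xS pS v; have [->|v0] := eqVneq v 0.
  rewrite /half_count (@eq_count _ _ pred0) ?count_pred0 // => y.
  by rewrite /dotp /= !mul0r addr0 ltxx.
(* The tilt respects every strict comparison of points of [S] in direction [v] and breaks ties by
   [rot v], so [dotp v'] is injective on [S]. *)
have [e e0 He] := small_perturbation (allpairs
  (fun y z => (dotp v (y - z), dotp (rot v) (y - z))) S S).
pose v' := v + scale2 e (rot v).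
have v'E y : dotp v' y = dotp v y + e * dotp (rot v) y.
  by rewrite dotpDl dotpZl.
have sg y z : y \in S -> z \in S -> 0 < dotp v (y - z) -> 0 < dotp v' (y - z).
  move=> yS zS yz; rewrite v'E.
  by have /small_perturbation_sg[/(_ yz)] :=
    He _ (allpairs_f _ yS zS) (lt0r_neq0 yz).
have v'inj : {in S &, injective (dotp v')}.
  move=> y z yS zS /eqP; rewrite -subr_eq0 -dotpBr => /eqP E.
  case: (ltgtP 0 (dotp v (y - z))) => [||yz].
  - by move/(sg _ _ yS zS); rewrite E ltxx.
  - rewrite -oppr_gt0 dotpBr opprB -dotpBr => /(sg _ _ zS yS).
    by rewrite dotpBr -opprB -dotpBr E oppr0 ltxx.
  apply/eqP; rewrite -subr_eq0; apply/eqP/(dotp_rot_eq0 v0) => //.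
  by move/eqP: E; rewrite v'E -yz add0r mulf_eq0 gt_eqF //= => /eqP.
(* Since [rot v] is orthogonal to [v], [dotp v' v] equals [dotp v v], which is positive. *)
have v'0 : v' != 0.
  apply/negP => /eqP E; have := dotp_gt0 v0.
  have := v'E v; rewrite (_ : v' = 0) // /dotp /rot /= => E'.
  by rewrite (_ : _ + _ = 0) ?ltxx //; move: E'; lra.
have [m mS med] := exists_median hS v'inj.
pose l := Line (dotp v' m) v'0.
have lS : {in S, on_line l =1 pred1 m}.
  by move=> y yS; rewrite /= /on_line /=; apply/eqP/eqP => [/v'inj->|->].
have lP : perfect S l.
  split; rewrite /good !card_fset_sep //.
  by rewrite (eq_in_count lS) count_uniq_mem ?fset_uniq // mS.
have xm : x = m by apply/eqP; rewrite -[_ == _]/(pred1 m x) -lS // pS.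
rewrite -xm in med.
(* Passing to [v'] loses no point, and by [med] twice the new count is the total of two disjoint
   open half-planes. *)
apply: (@leq_trans (count (fun y => dotp v' x < dotp v' y) S).*2).
  rewrite leq_double; apply: sub_in_count => y yS /(sg _ _ yS xS).
  by rewrite dotpBr subr_gt0.
rewrite -addnn -{1}med -(count_predT S).
by apply: sub_count_disjoint2 => // y /ltW; rewrite leNgt.
Qed.

(** * Points on opposite rays from [x], and even-balanced lines *)

Definition opposite x y z : bool :=
  (dotp (rot (y - x)) (z - x) == 0) && (dotp (y - x) (z - x) < 0).

Lemma opposite_sym x y z : opposite x y z = opposite x z y.
Proof.
rewrite /opposite -[in RHS]oppr_eq0.
by congr (_ && _); [congr (_ == _)|congr (_ < _)]; rewrite /dotp /rot /=; ring.
Qed.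

Lemma opposite_scale x y z : opposite x y z ->
  exists2 t : R, 0 < t & z - x = scale2 (- t) (y - x).
Proof.
move=> /andP[/eqP yz0 yz].
have yx : y - x != 0.
  by apply: contraTneq yz => ->; rewrite /dotp /= !mul0r addr0 ltxx.
have yy := dotp_gt0 yx.
exists (- dotp (y - x) (z - x) / dotp (y - x) (y - x)).
  by rewrite divr_gt0 ?oppr_gt0.
move: (y - x) (z - x) yz0 yy {yz yx} => [d1 d2] [z1 z2].
rewrite /dotp /rot /scale2 /= => yz0 yy.
have yz : d1 * z2 = d2 * z1 by lra.
by congr (_, _); apply: (mulIf (lt0r_neq0 yy));
  rewrite !mulNr opprK [_ / _ * _]mulrAC divfK ?lt0r_neq0 //; ring: yz.
Qed.

(** This is even balance of the line through [x] and [y]; with normal [rot (y - x)] its direction is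
    [- (y - x)], so its positive half-line is the ray opposite to [y]. *)
Lemma even_balanced_opposite S x y : all_lines_even_balanced S x -> y != x ->
  count (opposite x y) S =
  count (fun z => (dotp (rot (y - x)) (z - x) == 0) &&
                  (0 < dotp (y - x) (z - x))) S.
Proof.
move=> eS yx; have n0 : rot (y - x) != 0 by rewrite rot_neq0 ?subr_eq0.
pose l := Line (dotp (rot (y - x)) x) n0.
have lx : on_line l x by rewrite /on_line eqxx.
have rr d z : dotp (rot (rot d)) z = - dotp d z.
  by rewrite /dotp /rot /=; ring.
have /(even_balanced_count _ lx) /= E := eS l lx.
by apply: etrans (etrans _ E) _; apply: eq_count => z /=;
  rewrite rr ?oppr_gt0 ?oppr_lt0.
Qed.

(* Double counting of the pairs of opposite points, weighted so that each point
   of either half-plane has total weight 1. *)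
Lemma all_even_balanced_good S x :
  all_lines_even_balanced S x -> all_lines_good S x.
Proof.
move=> eS l lx; apply/(good_half_count _ lx).
move: (normal l) => v {l lx}.
pose N y := count (opposite x y) S.
have N_opp y z : opposite x y z -> N z = N y.
  move=> yz; have yx : y != x.
    apply: contraTneq yz => ->.
    by rewrite /opposite subrr /dotp /= !mul0r !addr0 ltxx andbF.
  (* The points opposite to [z] form the ray of [y], which has as many points of [S] as the ray
     opposite to [y]. *)
  rewrite [RHS](even_balanced_opposite eS yx).
  have [t t0 zE] := opposite_scale yz.
  apply: eq_count => u; rewrite /opposite zE.
  have -> d w : dotp (rot (scale2 (- t) d)) w = - (t * dotp (rot d) w).
    by rewrite /dotp /rot /=; ring.
  by rewrite dotpZl mulNr oppr_eq0 oppr_lt0 mulf_eq0 (gt_eqF t0) /= pmulr_rgt0.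
have N_gt0 y : y \in S -> dotp v (y - x) != 0 -> (0 < N y)%N.
  move=> yS vy; have yx : y != x.
    by apply: contraNneq vy => ->; rewrite subrr /dotp /= !mulr0 addr0.
  (* The ray of [y] contains [y], so the opposite ray meets [S] too and the weight [(N y)%:R^-1] is
     a true inverse. *)
  rewrite /N (even_balanced_opposite eS yx) -has_count; apply/hasP.
  exists y => //; rewrite dotp_gt0 ?subr_eq0 // andbT /dotp /rot /=.
  by apply/eqP; ring.
have side y z : opposite x y z -> (0 < dotp v (y - x)) = (0 < dotp (- v) (z - x)).
  move=> /opposite_scale[t t0 ->].
  have -> d : dotp (- v) (scale2 (- t) d) = t * dotp v d.
    by rewrite /dotp /=; ring.
  by rewrite pmulr_rgt0.
have sum1N (u : R * R) : (forall y, 0 < dotp u (y - x) -> dotp v (y - x) != 0) ->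
    (half_count S x u)%:R = \sum_(y <- S | 0 < dotp u (y - x))
      \sum_(z <- S | opposite x y z) ((N y)%:R^-1 : rat).
  move=> uv; rewrite /half_count -sum1_count natr_sum.
  rewrite big_seq_cond [RHS]big_seq_cond; apply: eq_bigr => y /andP[yS /uv vy].
  rewrite big_const_seq iter_addr_0 -[count _ _]/(N y) -[RHS]mulr_natr mulVf //.
  by rewrite pnatr_eq0 -lt0n N_gt0.
apply/eqP; rewrite -(eqr_nat rat) !sum1N; last 2 first.
- by move=> y; rewrite dotpNl oppr_gt0 lt_neqAle => /andP[].
- by move=> y /lt0r_neq0.
(* The same pairs are regrouped by their point in the other half-plane; [N_opp] makes the weight
   symmetric. *)
rewrite (exchange_big_dep (fun z => 0 < dotp (- v) (z - x))) /=; last first.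
  by move=> y z vy /side <-.
apply/eqP/eq_bigr => z vz; rewrite (eq_bigl (opposite x z)) => [|y]; last first.
  rewrite [RHS]opposite_sym; case yz: (opposite x y z); last by rewrite andbF.
  by rewrite (side _ _ yz) vz.
by apply: eq_bigr => y /N_opp->.
Qed.

End Plane.

Theorem theorem4 (R : realType) (S : {fset R * R}) (hS : odd #|` S|%fset) :
  (forall x : R * R, x \in S ->
     (all_lines_good S x <-> all_perfect_lines_through S x) /\
     (all_perfect_lines_through S x <-> all_lines_even_balanced S x)) /\
  (alice_wins S <->
     exists x : R * R, x \in S /\
       [/\ all_lines_good S x, all_perfect_lines_through S x
         & all_lines_even_balanced S x]) /\
  (forall x : R * R, x \in S ->
     [/\ all_lines_good S x, all_perfect_lines_through S x
       & all_lines_even_balanced S x] ->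
     winning_point S x).
Proof.
split; last split.
- move=> x xS; split; split.
  + exact: all_lines_good_perfect.
  + by move/(all_perfect_central hS xS); apply: central_good.
  + by move/(all_perfect_central hS xS); apply: central_even_balanced.
  + by move/all_even_balanced_good; apply: all_lines_good_perfect.
- split=> [[x /winning_point_central cS]|[x [_ [gS _ _]]]]; last first.
    by exists x; apply: all_lines_good_winning.
  exists x; have xS := central_mem hS cS; have gS := central_good hS cS.
  split=> //; split=> //; first exact: all_lines_good_perfect.
  exact: central_even_balanced.
- by move=> x _ [gS _ _]; apply: all_lines_good_winning.
Qed.
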